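(* Let $q\geq 1$. Let $Y_1,\dots,Y_n$ be jointly distributed (not necessarily independent) nonnegative random variables, and let $X_1,\dots,X_n$ be independent random variables such that each $X_i$ has the same distribution as $Y_i$. Then $$\Big\|\sum_{i=1}^n X_i\Big\|_q \leq A_q^{1/q}\,\Big\|\sum_{i=1}^n Y_i\Big\|_q,$$ where $A_q$ is the fractional Bell number, i.e. $A_q=\mathbb{E}[P^q]=\sum_{t=1}^{\infty} t^q\frac{e^{-1}}{t!}$ for a Poisson random variable $P$ with parameter $1$. Moreover, $A_q^{1/q}$ is the optimal constant: no constant $C_q<A_q^{1/q}$ makes the inequality $\|\sum_{i=1}^n X_i\|_q\leq C_q\|\sum_{i=1}^n Y_i\|_q$ hold for all $n$ and all such $X_1,\dots,X_n$, $Y_1,\dots,Y_n$.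
   Context: Here $\|Z\|_q=(\mathbb{E}|Z|^q)^{1/q}$ denotes the $L_q$ norm of a random variable $Z$. This is the de la Peña decoupling inequality $\|\sum_i X_i\|_q\le C_q\|\sum_i Y_i\|_q$ with the constant determined exactly. *)

(* Defs.v *)
From HB Require Import structures.
From mathcomp Require Import all_boot all_order all_algebra.
From mathcomp Require Import all_classical all_reals all_analysis.
Set Implicit Arguments. Unset Strict Implicit. Unset Printing Implicit Defensive.
Import Order.TTheory GRing.Theory Num.Theory.
Local Open Scope classical_set_scope.
Local Open Scope ring_scope.

(* Fractional Bell number A_q = sum_{t >= 1} t^q e^{-1} / t!  (= E[P^q],
   P ~ Poisson(1)), as an extended-real series of nonnegative terms. *)
Definition fractional_bell (R : realType) (q : R) : \bar R :=
  (\sum_(1 <= t <oo) (((t%:R : R) `^ q) * expR (-1) / (t`!)%:R)%:E)%E.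

Definition mutually_independent d (T : measurableType d) (R : realType)
    (P : probability T R) (n : nat) (X : 'I_n -> {RV P >-> R}) : Prop :=
  forall B : 'I_n -> set R, (forall i, measurable (B i)) ->
    P (\bigcap_(i in [set: 'I_n]) (X i @^-1` B i)) =
    (\prod_(i < n) P (X i @^-1` B i))%E.

Definition same_distribution d d' (T : measurableType d) (T' : measurableType d')
    (R : realType) (P : probability T R) (P' : probability T' R)
    (X : {RV P >-> R}) (Y : {RV P' >-> R}) : Prop :=
  forall B : set R, measurable B -> distribution P X B = distribution P' Y B.

Definition Lq_sum d (T : measurableType d) (R : realType) (P : probability T R)
    (n : nat) (Z : 'I_n -> {RV P >-> R}) (q : R) : \bar R :=
  Lnorm P q%:E (fun w => (\sum_(i < n) Z i w)%:E).

(* Main.v *)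
Require Import Defs.
From HB Require Import structures.
From mathcomp Require Import all_boot all_order all_algebra.
From mathcomp Require Import all_classical all_reals all_analysis.
From mathcomp Require Import measurable_realfun ring lra.
Import Order.TTheory GRing.Theory Num.Theory.
Local Open Scope classical_set_scope.
Local Open Scope ring_scope.
Set Implicit Arguments. Unset Strict Implicit. Unset Printing Implicit Defensive.

(** For a nonnegative variable U, let K_U g x = E (g (x + U)), and consider the
    cone of functions g whose increments g (x + u) - g x are nonnegative and
    nondecreasing in x on [0, +oo[. The operators K_U preserve this cone and
    commute, and (U, V) may be dependent in

      K_(U+V)^t g - K_U^t g >= t (K_V - 1) K_U^(t-1) g.

    Averaging over t ~ Poisson(1), whose weights satisfy p_t t = p_(t-1), gives
    E_t (K_V K_U^t g) <= E_t (K_(U+V)^t g): an independent copy of V can be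
    absorbed into a Poisson number of independent copies of (U, V). Adding the
    Y_i one by one yields E (X_1 + ... + X_n)^q <= E (S_1 + ... + S_P)^q with
    S_k independent copies of Y_1 + ... + Y_n and P ~ Poisson(1), and Minkowski
    bounds the right-hand side by E P^q times E (Y_1 + ... + Y_n)^q.

    For sharpness, let Y_i be the indicator of j = i for a uniform j in 'I_n,
    so that their sum is 1, while the sum of the X_i is binomial (n, 1/n) and
    converges to Poisson(1). *)

(** * Mean shifts of functions with convex growth *)

(* The growth bound is stable under shift_mean because
   1 + x + u <= (1 + x) (1 + u); it makes every value finite, which is what
   allows cancellation in \bar R. *)
Record growth_convex (R : realType) (q : R) (g : R -> \bar R) : Prop := {
  gc_meas : measurable_fun [set: R] g;
  gc_ge0 : forall x, (0 <= g x)%E;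
  gc_bound : exists2 C : R, 0 <= C &
    forall x, (g x <= (C * (1 + `|x|) `^ q)%:E)%E;
  gc_incr : forall x u : R, 0 <= x -> 0 <= u -> (g x <= g (x + u)%R)%E;
  gc_supadd : forall x u v : R, 0 <= x -> 0 <= u -> 0 <= v ->
    (g (x + u)%R + g (x + v)%R <= g (x + u + v)%R + g x)%E }.

(** The first two inequalities plus n times the third; all terms are finite, so the common ones
    cancel. This is the arithmetic of the induction step in [iter_shift_mean_supadd]. *)
Lemma supadd_step (R : realType) (a b c e f k l n : R) : 0 <= n ->
  (a%:E + n%:E * b%:E <= c%:E + n%:E * e%:E)%E ->
  (f%:E + k%:E <= a%:E + l%:E)%E -> (k%:E + e%:E <= b%:E + l%:E)%E ->
  (f%:E + (n + 1)%:E * k%:E <= c%:E + (n + 1)%:E * l%:E)%E.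
Proof.
by rewrite -!EFinM -!EFinD !lee_fin => n0 h1 h2 /(ler_wpM2l n0); lra.
Qed.

Section shift_mean.
Context d (T : measurableType d) (R : realType) (P : probability T R).
Implicit Types (U V : T -> R) (g h : R -> \bar R).

(** The operator K_U. It takes values in [\bar R] so that it can be iterated before integrability is
    known. *)
Definition shift_mean U g (x : R) : \bar R := (\int[P]_w g (x + U w)%R)%E.

(** The moment of 1 + U, rather than of U, is the factor by which [shift_mean U] enlarges the
    constant in [gc_bound]. *)
Record weighted_moment (q : R) U : Prop := {
  wm_meas : measurable_fun [set: T] U;
  wm_ge0 : forall w, 0 <= U w;
  wm_fin : (\int[P]_w ((1 + U w) `^ q)%:E < +oo)%E }.

Lemma measurable_shift U g (x : R) : measurable_fun [set: T] U ->
  measurable_fun [set: R] g -> measurable_fun [set: T] (fun w => g (x + U w)).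
Proof.
move=> mU mg; apply: (measurableT_comp mg).
by apply: measurable_funD.
Qed.

Lemma shift_mean_ge0 U g x : (forall y, (0 <= g y)%E) -> (0 <= shift_mean U g x)%E.
Proof. by move=> g0; apply: integral_ge0 => w _. Qed.

Lemma measurable_shift_mean U g : measurable_fun [set: T] U ->
  measurable_fun [set: R] g -> (forall y, (0 <= g y)%E) ->
  measurable_fun [set: R] (shift_mean U g).
Proof.
move=> mU mg g0.
apply: (@measurable_fun_fubini_tonelli_F _ _ _ _ _ P
  (fun z : R * T => g (z.1 + U z.2))) => //.
apply: (measurableT_comp mg); apply: measurable_funD => //.
exact: (measurableT_comp mU).
Qed.

Lemma le_shift_mean U g h x : measurable_fun [set: T] U -> (forall w, 0 <= U w) ->
  measurable_fun [set: R] g -> (forall y, (0 <= g y)%E) ->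
  measurable_fun [set: R] h ->
  (forall y, 0 <= y -> (g y <= h y)%E) -> 0 <= x ->
  (shift_mean U g x <= shift_mean U h x)%E.
Proof.
move=> mU U0 mg g0 mh gh x0; apply: ge0_le_integral => //.
- exact: measurable_shift.
- exact: measurable_shift.
- by move=> w _; apply: gh; rewrite addr_ge0.
Qed.

Lemma shift_meanD U g h x : measurable_fun [set: T] U ->
  measurable_fun [set: R] g -> (forall y, (0 <= g y)%E) ->
  measurable_fun [set: R] h -> (forall y, (0 <= h y)%E) ->
  (shift_mean U (fun y => g y + h y) x = shift_mean U g x + shift_mean U h x)%E.
Proof.
by move=> mU mg g0 mh h0; apply: ge0_integralD => //; exact: measurable_shift.
Qed.

Lemma shift_meanZ U g (c : R) x : measurable_fun [set: T] U -> 0 <= c ->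
  measurable_fun [set: R] g -> (forall y, (0 <= g y)%E) ->
  (shift_mean U (fun y => c%:E * g y) x = c%:E * shift_mean U g x)%E.
Proof.
by move=> mU c0 mg g0; apply: ge0_integralZl => //; exact: measurable_shift.
Qed.

(** Tonelli: each operator integrates over its own copy of T, so U and V enter as if they were
    independent. *)
Lemma shift_mean_comm U V g x : measurable_fun [set: T] U ->
  measurable_fun [set: T] V ->
  measurable_fun [set: R] g -> (forall y, (0 <= g y)%E) ->
  shift_mean U (shift_mean V g) x = shift_mean V (shift_mean U g) x.
Proof.
move=> mU mV mg g0.
rewrite /shift_mean.
rewrite (fubini_tonelli (fun z : T * T => g (x + U z.1 + V z.2))) //; last first.
  apply: (measurableT_comp mg); apply: measurable_funD => //; last first.
    exact: (measurableT_comp mV).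
  by apply: measurable_funD => //; exact: (measurableT_comp mU).
apply: eq_integral => w _; apply: eq_integral => w' _ /=.
by rewrite addrAC.
Qed.

Lemma probability_integral_cst (c : \bar R) : (\int[P]_w c = c)%E.
Proof. by rewrite integral_cst// [X in (_ * X)%E]probability_setT mule1. Qed.

Variable q : R.
Hypothesis q1 : 1 <= q.

Lemma shift_mean_gc U g : weighted_moment q U -> growth_convex q g ->
  growth_convex q (shift_mean U g).
Proof.
move=> [mU U0 Ufin] [mg g0 [C C0 gC] gi gs].
have q0 : 0 <= q by exact: le_trans q1.
split.
- exact: measurable_shift_mean.
- by move=> x; exact: shift_mean_ge0.
- set M := (\int[P]_w ((1 + U w) `^ q)%:E)%E in Ufin.
  have M0 : (0 <= M)%E by apply: integral_ge0 => w _; rewrite lee_fin powR_ge0.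
  have Mfin : M \is a fin_num by rewrite ge0_fin_numE.
  have mU1 : measurable_fun setT (fun w => ((1 + U w) `^ q)%:E).
    apply/measurable_EFinP.
    apply: (measurableT_comp (measurable_powR _)).
    exact: measurable_funD.
  exists (C * fine M); first by rewrite mulr_ge0// fine_ge0.
  move=> x; rewrite mulrAC EFinM fineK//.
  rewrite /M -ge0_integralZl//; last 2 first.
  + by move=> w _; rewrite lee_fin powR_ge0.
  + by rewrite lee_fin mulr_ge0// powR_ge0.
  apply: ge0_le_integral => //.
  + exact: measurable_shift.
  + by apply: emeasurable_funM => //.
  move=> w _; apply: (le_trans (gC _)).
  have a0 : 0 <= 1 + `|x| by rewrite addr_ge0.
  have b0 : 0 <= 1 + U w by rewrite addr_ge0.
  rewrite -EFinM lee_fin -mulrA ler_wpM2l// -powRM//.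
  apply: ge0_ler_powR => //; rewrite ?nnegrE ?mulr_ge0 ?addr_ge0//.
  have := ler_normD x (U w); rewrite (ger0_norm (U0 w)).
  have := mulr_ge0 (normr_ge0 x) (U0 w).
  by lra.
- move=> x u x0 u0; apply: ge0_le_integral => //.
  + exact: measurable_shift.
  + exact: measurable_shift.
  + by move=> w _; rewrite addrAC; apply: gi => //; rewrite addr_ge0.
- move=> x u v x0 u0 v0; rewrite /shift_mean.
  have ms y := measurable_shift y mU mg.
  rewrite -!ge0_integralD//; apply: ge0_le_integral => //.
  + by move=> w _; rewrite adde_ge0.
  + by apply: emeasurable_funD.
  + by apply: emeasurable_funD.
  + move=> w _; rewrite (addrAC (x + u)) (addrAC x u) (addrAC x v).
    by apply: gs => //; rewrite addr_ge0.
Qed.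

Lemma iter_shift_mean_gc U g t : weighted_moment q U -> growth_convex q g ->
  growth_convex q (iter t (shift_mean U) g).
Proof.
by move=> wU cg; elim: t => [//|t IH]; rewrite iterS; exact: shift_mean_gc.
Qed.

Lemma gc_fin g x : growth_convex q g -> g x = (fine (g x))%:E.
Proof.
case=> _ g0 [C _ gC] _ _; rewrite fineK// ge0_fin_numE//.
by apply: le_lt_trans (gC x) _; rewrite ltry.
Qed.

Lemma iter_shift_mean_comm U V g t x : weighted_moment q U ->
  weighted_moment q V -> growth_convex q g ->
  iter t (shift_mean U) (shift_mean V g) x =
  shift_mean V (iter t (shift_mean U) g) x.
Proof.
move=> wU wV cg; suff -> : iter t (shift_mean U) (shift_mean V g) =
  shift_mean V (iter t (shift_mean U) g) by [].
elim: t => [//|t IH]; rewrite !iterS IH; apply/funext => y.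
have [? ? _ _ _] := iter_shift_mean_gc t wU cg.
by rewrite shift_mean_comm//; [case: wU|case: wV].
Qed.

(** * Comparison with the shift by a dependent sum *)

Section step.
Variables (U V : T -> R).
Hypotheses (wU : weighted_moment q U) (wV : weighted_moment q V).
Hypothesis wW : weighted_moment q (U \+ V).
Let W := U \+ V.

(** Integrates [gc_supadd] with increments U w and V w taken at the same w, which is why U and V may
    be dependent. *)
Lemma shift_mean_supadd g x : growth_convex q g -> 0 <= x ->
  (shift_mean U g x + shift_mean V g x <= shift_mean W g x + g x)%E.
Proof.
move=> [mg g0 _ gi gs] x0; rewrite -(probability_integral_cst (g x)).
have [[[mU U0 _] [mV V0 _]] [mW _ _]] := (wU, wV, wW).
have mUx := measurable_shift x mU mg.
have mVx := measurable_shift x mV mg.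
have mWx := measurable_shift x mW mg.
rewrite /shift_mean -!ge0_integralD//; apply: ge0_le_integral => //.
- by move=> w _; rewrite adde_ge0.
- exact: emeasurable_funD.
- exact: emeasurable_funD.
- by move=> w _; rewrite /W /= addrA; exact: gs.
Qed.

(** K_V g - g is nondecreasing on the half-line and x + U w <= x + W w, so its mean after a shift by
    U is at most its mean after a shift by W. The subtracted terms are moved across. *)
Lemma shift_mean_incr_supadd g x : growth_convex q g -> 0 <= x ->
  (shift_mean U (shift_mean V g) x + shift_mean W g x <=
   shift_mean W (shift_mean V g) x + shift_mean U g x)%E.
Proof.
move=> cg x0.
have [[[mU U0 _] [mV V0 _]] [mW _ _]] := (wU, wV, wW).
have [mg g0 _ _ gs] := cg; have [mVg Vg0 _ _ _] := shift_mean_gc wV cg.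
have ms U' (g' : R -> \bar R) := @measurable_shift U' g' x.
have E U' (h : R -> \bar R) : shift_mean U' h x = (\int[P]_w h (x + U' w)%R)%E by [].
rewrite !E -!ge0_integralD//; try exact: ms.
apply: ge0_le_integral => //.
- by move=> w _; rewrite adde_ge0.
- by apply: emeasurable_funD; exact: ms.
- by apply: emeasurable_funD; exact: ms.
- move=> w _; rewrite /W /= addrA.
  have y0 : 0 <= x + U w by rewrite addr_ge0.
  move: (x + U w) y0 => y y0.
  (* Both values become integrals over a fresh w', so that [gc_supadd] applies with increments V w'
     and V w. *)
  rewrite -(probability_integral_cst (g (y + V w))) -(probability_integral_cst (g y)).
  have my z := @measurable_shift V g z mV mg.
  rewrite /shift_mean -!ge0_integralD//.
  apply: ge0_le_integral => //.
  + by move=> w' _; rewrite adde_ge0.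
  + exact: emeasurable_funD.
  + exact: emeasurable_funD.
  + by move=> w' _; rewrite (addrAC _ (V w)); exact: gs.
Qed.

(** With n = t + 1, K_W^(n+1) - K_U^(n+1) = K_W (K_W^n - K_U^n) + (K_W - K_U) K_U^n. By induction
    the first term is at least n K_W (K_V - 1) K_U^t, hence at least n (K_V - 1) K_U^n by
    [shift_mean_incr_supadd] and commutation; the second is at least (K_V - 1) K_U^n. *)
Lemma iter_shift_mean_supadd g t x : growth_convex q g -> 0 <= x ->
  (iter t.+1 (shift_mean U) g x +
     t.+1%:R%:E * shift_mean V (iter t (shift_mean U) g) x <=
   iter t.+1 (shift_mean W) g x + t.+1%:R%:E * iter t (shift_mean U) g x)%E.
Proof.
move=> cg; elim: t x => [|t IH] x x0.
  by rewrite !mul1e /=; exact: shift_mean_supadd.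
have cU s := iter_shift_mean_gc s wU cg.
have cW s := iter_shift_mean_gc s wW cg.
have cVU s := shift_mean_gc wV (cU s).
have [[[mU U0 _] [mV V0 _]] [mW W0 _]] := (wU, wV, wW).
set n := t.+1.
have n0 : (0 : R) <= n%:R by [].
have step1 : (shift_mean W (iter n (shift_mean U) g) x +
    n%:R%:E * shift_mean W (shift_mean V (iter t (shift_mean U) g)) x <=
  shift_mean W (iter n (shift_mean W) g) x +
    n%:R%:E * shift_mean W (iter t (shift_mean U) g) x)%E.
  have [? ? _ _ _] := cU n; have [? ? _ _ _] := cU t.
  have [? ? _ _ _] := cVU t; have [? ? _ _ _] := cW n.
  have mZ (h : R -> \bar R) : measurable_fun setT h ->
      measurable_fun setT (fun y => n%:R%:E * h y)%E.
    by move=> mh; exact: emeasurable_funM.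
  have Z0 (h : R -> \bar R) : (forall y, 0 <= h y)%E ->
    (forall y, 0 <= n%:R%:E * h y)%E by move=> h0 y; rewrite mule_ge0.
  rewrite -!shift_meanZ// -!shift_meanD//; try exact: mZ; try exact: Z0.
  apply: le_shift_mean => //.
  - by apply: emeasurable_funD => //; exact: mZ.
  - by move=> y; rewrite adde_ge0// Z0.
  - by apply: emeasurable_funD => //; exact: mZ.
have step2 := shift_mean_supadd (cU n) x0.
have step3 := shift_mean_incr_supadd (cU t) x0.
move: step1 step2 step3.
have -> : shift_mean U (shift_mean V (iter t (shift_mean U) g)) x =
    shift_mean V (iter n (shift_mean U) g) x.
  by have [? ? _ _ _] := cU t; rewrite shift_mean_comm.
rewrite [iter n.+1 (shift_mean U) g]iterS [iter n.+1 (shift_mean W) g]iterS.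
rewrite -[shift_mean U (iter t _ _) x]/(iter n (shift_mean U) g x).
have c1 := shift_mean_gc wU (cU n).
have c2 := shift_mean_gc wW (cU n).
have c3 := shift_mean_gc wW (cVU t).
have c4 := shift_mean_gc wW (cW n).
have c5 := shift_mean_gc wW (cU t).
rewrite (gc_fin x c1) (gc_fin x c2) (gc_fin x c3) (gc_fin x c4) (gc_fin x c5).
rewrite (gc_fin x (cVU n)) (gc_fin x (cU n)).
move=> step1 step2 step3; rewrite -[n.+1]addn1 natrD.
exact: supadd_step n0 step1 step2 step3.
Qed.

(** * Averaging over a Poisson number of shifts *)

Definition poisson1 (t : nat) : R := expR (-1) / t`!%:R.

Lemma poisson1_ge0 t : 0 <= poisson1 t.
Proof. by rewrite /poisson1 divr_ge0// expR_ge0. Qed.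

Lemma poisson1S t : poisson1 t.+1 * t.+1%:R = poisson1 t.
Proof.
by rewrite /poisson1 factS natrM invfM mulrA mulrAC mulfVK// pnatr_eq0.
Qed.

(** E g (x + U_1 + ... + U_P) for independent copies U_k of U and an independent P ~ Poisson(1),
    written without constructing these variables. *)
Definition poisson_mean U g x : \bar R :=
  (\sum_(0 <= t <oo) (poisson1 t)%:E * iter t (shift_mean U) g x)%E.

Lemma poisson_meanD g x : growth_convex q g -> 0 <= x ->
  (poisson_mean U (shift_mean V g) x <= poisson_mean W g x)%E.
Proof.
move=> cg x0; rewrite /poisson_mean.
have cU s := iter_shift_mean_gc s wU cg.
have cW s := iter_shift_mean_gc s wW cg.
have cVU s := shift_mean_gc wV (cU s).
under eq_eseriesr do rewrite iter_shift_mean_comm//.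
apply: lime_le.
  apply: is_cvg_nneseries => t _ _; rewrite mule_ge0//.
    by rewrite lee_fin poisson1_ge0.
  exact: gc_ge0 (cVU t) _.
apply: nearW => N.
apply: (@le_trans _ _ (\sum_(0 <= t < N.+1) (poisson1 t)%:E *
    iter t (shift_mean W) g x)%E); last first.
  apply: nneseries_lim_ge => t _ _; rewrite mule_ge0 ?lee_fin ?poisson1_ge0//.
  exact: gc_ge0 (cW t) _.
(* The boundary term p_N K_U^N g closes the induction on N: the step adds p_(N+1) times
   [iter_shift_mean_supadd], and p_(N+1) (N + 1) = p_N makes the terms telescope. *)
apply: (@le_trans _ _ (\sum_(0 <= t < N) (poisson1 t)%:E *
   shift_mean V (iter t (shift_mean U) g) x + (poisson1 N)%:E *
   iter N (shift_mean U) g x)%E).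
  rewrite leeDl// mule_ge0 ?lee_fin ?poisson1_ge0//; exact: gc_ge0 (cU N) _.
elim: N => [|N IH]; first by rewrite big_geq// big_nat1 add0e.
rewrite [leRHS]big_nat_recr//=.
apply: le_trans (leeD IH (lexx _)).
rewrite [in leLHS]big_nat_recr//=.
rewrite -!addeA leeD2l//.
have := iter_shift_mean_supadd N cg x0.
rewrite -!iterS.
rewrite (gc_fin x (cU N)) (gc_fin x (cU N.+1)) (gc_fin x (cW N.+1)) (gc_fin x (cVU N)).
rewrite -!EFinM -!EFinD !lee_fin -poisson1S => h.
have := ler_wpM2l (poisson1_ge0 N.+1) h; lra.
Qed.

End step.
End shift_mean.

(** * Sums of independent variables *)

Section independence.
Context d (T : measurableType d) (R : realType) (P : probability T R).

Let PT : P [set: T] = 1%E. Proof. exact: probability_setT. Qed.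

(** Normalised by P E, the law of (S, X) on E agrees with the product measure on rectangles, hence
    everywhere. This reaches events on the sum of S and X. *)
Lemma distribution_pair_restr (S X : {mfun T >-> R}) (E : set T) :
  measurable E ->
  (forall A B, measurable A -> measurable B ->
     P ((S @^-1` A `&` X @^-1` B) `&` E) =
     (P (S @^-1` A) * P (X @^-1` B) * P E)%E) ->
  forall C : set (R * R), measurable C ->
    P ([set w | C (S w, X w)] `&` E) =
    ((distribution P S \x distribution P X) C * P E)%E.
Proof.
move=> mE PSXE C mC.
have mSX : measurable_fun [set: T] (fun w => (S w, X w)).
  exact: measurable_fun_pair.
have mSXC : measurable [set w | C (S w, X w)].
  by rewrite -[X in measurable X]setTI; exact: mSX.
(* The normalisation divides by P E; when P E vanishes both sides are 0. *)
have [PE0|PE0] := eqVneq (P E) 0%E.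
  rewrite PE0 mule0; apply/eqP; rewrite eq_le measure_ge0 andbT -PE0.
  by apply: le_measure; rewrite ?inE//; exact: measurableI.
have PEfin : P E \is a fin_num by exact: fin_num_measure.
pose c := fine (P E).
have PEc : P E = c%:E by rewrite /c fineK.
have c0 : 0 < c.
  by rewrite -lte_fin -PEc lt_neqAle measure_ge0 eq_sym PE0.
have ci0 : 0 <= c^-1 by rewrite invr_ge0 ltW.
pose phi : {mfun T >-> (R * R)%type} := mfun_Sub (mem_set mSX).
pose m0 := mscale (NngNum ci0) (pushforward (mrestr P mE) phi).
pose m' := m0 mSX.
have m'E A B : measurable A -> measurable B ->
    m' (A `*` B) = (distribution P S A * distribution P X B)%E.
  move=> mA mB; rewrite /m' /m0 /mscale /= /pushforward /mrestr.
  have -> : phi @^-1` (A `*` B) `&` E = (S @^-1` A `&` X @^-1` B) `&` E by [].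
  rewrite PSXE// PEc muleCA -EFinM mulVf ?mule1//.
  by rewrite gt_eqF.
rewrite (product_measure_unique m'E mC) /m' /m0 /mscale /= /pushforward /mrestr PEc.
by rewrite muleAC -EFinM mulVf ?gt_eqF// mul1e.
Qed.

(** The law of (S, X) is the product of the two laws, and Tonelli integrates X out first with S
    fixed. *)
Lemma integral_indep (S X : {mfun T >-> R}) (g : R -> \bar R) (x : R) :
  (forall A B, measurable A -> measurable B ->
     P (S @^-1` A `&` X @^-1` B) = (P (S @^-1` A) * P (X @^-1` B))%E) ->
  measurable_fun [set: R] g -> (forall y, 0 <= g y)%E ->
  (\int[P]_w g (x + (X w + S w))%R)%E =
  (\int[P]_w shift_mean P X g (x + S w)%R)%E.
Proof.
move=> PSX mg g0.
have mSX : measurable_fun [set: T] (fun w => (S w, X w)).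
  exact: measurable_fun_pair.
pose phi : {mfun T >-> (R * R)%type} := mfun_Sub (mem_set mSX).
pose F (z : R * R) := g (x + (z.2 + z.1)).
have mF : measurable_fun [set: R * R] F.
  apply: (measurableT_comp mg); apply: measurable_funD => //.
  exact: measurable_funD.
have F0 z : (0 <= F z)%E by exact: g0.
transitivity (\int[distribution P phi]_z F z)%E.
  by rewrite ge0_integral_distribution.
transitivity (\int[distribution P S \x distribution P X]_z F z)%E.
  apply: eq_measure_integral => C mC _.
  have := @distribution_pair_restr S X setT measurableT _ C mC.
  rewrite setIT ?PT mule1; apply.
  by move=> A B mA mB; rewrite setIT ?PT mule1; exact: PSX.
rewrite fubini_tonelli1// ge0_integral_distribution//; last 2 first.
- exact: measurable_fun_fubini_tonelli_F.
- by move=> y; apply: integral_ge0 => z _; exact: g0.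
apply: eq_integral => w _ /=; rewrite /fubini_F /shift_mean.
rewrite ge0_integral_distribution//; last first.
  by apply: (measurableT_comp mF); exact: measurable_fun_pair.
by apply: eq_integral => w' _; rewrite /F /= (addrC (X w')) addrA.
Qed.

(** Carries the operator from the space of the X_i to that of the Y_i. *)
Lemma shift_mean_distribution d' (T' : measurableType d') (P' : probability T' R)
  (X : {RV P >-> R}) (Y : {RV P' >-> R}) (g : R -> \bar R) :
  measurable_fun [set: R] g -> (forall y, 0 <= g y)%E ->
  same_distribution X Y -> shift_mean P X g = shift_mean P' Y g.
Proof.
move=> mg g0 XY; apply/funext => x; rewrite /shift_mean.
have mgx : measurable_fun [set: R] (fun y => g (x + y)).
  by apply: (measurableT_comp mg); exact: measurable_funD.
transitivity (\int[distribution P X]_y g (x + y)%R)%E.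
  by rewrite ge0_integral_distribution.
transitivity (\int[distribution P' Y]_y g (x + y)%R)%E.
  by apply: eq_measure_integral => A mA _; exact: XY.
by rewrite ge0_integral_distribution.
Qed.

Variables (n : nat) (X : 'I_n -> {RV P >-> R}).
Hypothesis indepX : mutually_independent X.

Let partial (s : seq 'I_n) (w : T) := \sum_(i <- s) X i w.

Let mpartial s : measurable_fun [set: T] (partial s).
Proof. by apply: measurable_sum => i; exact: measurable_funP. Qed.

Let mpre (f : T -> R) (A : set R) : measurable_fun [set: T] f -> measurable A ->
  measurable (f @^-1` A).
Proof. by move=> mf mA; rewrite -[X in measurable X]setTI; exact: mf. Qed.

(** Induction on s. The condition [B i = setT] on s leaves the intersection to the variables outside
    s; as A and B are arbitrary, a constraint on X j can be moved into the family when j joins the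
    sum. *)
Lemma partial_sum_indep (s : seq 'I_n) : uniq s ->
  forall (A : set R) (B : 'I_n -> set R), measurable A ->
    (forall i, measurable (B i)) -> (forall i, i \in s -> B i = setT) ->
  P (partial s @^-1` A `&` \bigcap_(i in [set: 'I_n]) (X i @^-1` B i)) =
  (P (partial s @^-1` A) * \prod_(i < n) P (X i @^-1` B i))%E.
Proof.
elim: s => [_|j s IH /= /andP[js us]] A B mA mB Bs.
  have -> : partial [::] @^-1` A = if 0 \in A then setT else set0.
    apply/seteqP; split => w /=; rewrite /partial big_nil.
      by move=> A0; rewrite mem_set.
    by case: ifPn => // /set_mem.
  case: ifP => _; last by rewrite set0I measure0 mul0e.
  by rewrite setTI PT mul1e; exact: indepX.
have Bj : B j = setT by apply: Bs; rewrite mem_head.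
pose E := \bigcap_(i in [set: 'I_n]) (X i @^-1` B i).
have mE : measurable E.
  by apply: fin_bigcap_measurable => // i _; apply: mpre.
have PE : P E = (\prod_(i < n) P (X i @^-1` B i))%E by exact: indepX.
pose S : {mfun T >-> R} := mfun_Sub (mem_set (mpartial s)).
have key A1 A2 (B' : 'I_n -> set R) : measurable A1 -> measurable A2 ->
    (forall i, measurable (B' i)) -> (forall i, i \in j :: s -> B' i = setT) ->
    let E' := \bigcap_(i in [set: 'I_n]) (X i @^-1` B' i) in
    P ((S @^-1` A1 `&` X j @^-1` A2) `&` E') =
    (P (S @^-1` A1) * P (X j @^-1` A2) * P E')%E.
  move=> mA1 mA2 mB' B's E'.
  (* The constraint X j in A2 is stored as the j-th set of the family, where the induction
     hypothesis for s covers it. *)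
  pose B2 i := if i == j then A2 else B' i.
  have mB2 i : measurable (B2 i) by rewrite /B2; case: ifP.
  have := IH us A1 B2 mA1 mB2.
  have -> : \bigcap_(i in [set: 'I_n]) (X i @^-1` B2 i) = X j @^-1` A2 `&` E'.
    apply/seteqP; split => w /=.
      move=> H; split; first by have := H j I; rewrite /B2 /= eqxx.
      move=> i _ /=; have := H i I; rewrite /B2 /=; case: eqP => // -> _.
      by rewrite B's ?mem_head.
    by move=> [H1 H2] i _ /=; rewrite /B2; case: eqP => [->//|_]; exact: H2.
  rewrite setIA => ->; last first.
    move=> i si; rewrite /B2; case: eqP => [ij|_]; first by rewrite -ij si in js.
    by apply: B's; rewrite inE si orbT.
  rewrite -muleA; congr (_ * _)%E.
  rewrite (indepX mB') (bigD1 j)//= [in RHS](bigD1 j)//= /B2 eqxx; congr (_ * _)%E.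
  rewrite B's ?mem_head// preimage_setT PT mul1e.
  by apply: eq_bigr => i /negPf ->.
have PS := @distribution_pair_restr S (X j).
pose C := [set z : R * R | A (z.2 + z.1)].
have mC : measurable C.
  rewrite -[C]setTI; have : measurable_fun [set: R * R] (fun z => z.2 + z.1).
    exact: measurable_funD.
  by apply.
have eC : partial (j :: s) @^-1` A = [set w | C (S w, X j w)].
  by apply/seteqP; split => w /=; rewrite /partial big_cons.
rewrite -/E -PE eC (PS E mE)//; last first.
  by move=> A1 A2 mA1 mA2; exact: key.
congr (_ * _)%E.
have := PS setT measurableT _ C mC.
rewrite setIT PT mule1 => -> //.
move=> A1 A2 mA1 mA2.
(* With every set equal to [setT] the event is the whole space, and [key] becomes the independence
   of S and X j. *)
have := key A1 A2 (fun=> setT) mA1 mA2 (fun=> measurableT) (fun _ _ => erefl).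
rewrite /= (_ : \bigcap_(i in [set: 'I_n]) (X i @^-1` setT) = setT) ?PT//.
by apply/seteqP; split.
Qed.

Lemma integral_partial_sumS (j : 'I_n) (s : seq 'I_n) (g : R -> \bar R) x :
  uniq (j :: s) -> measurable_fun [set: R] g -> (forall y, 0 <= g y)%E ->
  (\int[P]_w g (x + \sum_(i <- j :: s) X i w)%R)%E =
  (\int[P]_w shift_mean P (X j) g (x + \sum_(i <- s) X i w)%R)%E.
Proof.
move=> /andP[js us] mg g0.
under eq_integral do rewrite big_cons.
pose S : {mfun T >-> R} := mfun_Sub (mem_set (mpartial s)).
apply: (@integral_indep S (X j)) => // A1 A2 mA1 mA2.
have := @partial_sum_indep s us A1 (fun i => if i == j then A2 else setT) mA1.
have -> : \bigcap_(i in [set: 'I_n]) (X i @^-1` (if i == j then A2 else setT)) =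
    X j @^-1` A2.
  apply/seteqP; split => w /=; first by move=> /(_ j I) /=; rewrite eqxx.
  by move=> Aw i _ /=; case: eqP => // ->.
move=> -> //.
- congr (_ * _)%E; rewrite (bigD1 j)//= eqxx big1 ?mule1// => i /negPf ->.
  by rewrite preimage_setT PT.
- by move=> i; case: ifP.
- by move=> i si; case: eqP => // ij; rewrite -ij si in js.
Qed.

End independence.

(** * The power function *)

Section power_function.
Context (R : realType) (q : R).
Hypothesis q1 : 1 <= q.

Let q0 : 0 <= q. Proof. exact: le_trans q1. Qed.

Lemma powR_supadd (x u v : R) : 0 <= x -> 0 <= u -> 0 <= v ->
  (x + u) `^ q + (x + v) `^ q <= (x + u + v) `^ q + x `^ q.
Proof.
move=> x0 u0 v0.
have [uv0|uv0] := eqVneq (u + v) 0.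
  have /andP[/eqP -> /eqP ->] : (u == 0) && (v == 0) by rewrite -paddr_eq0// uv0.
  by rewrite !addr0.
have s0 : 0 < u + v by rewrite lt_neqAle eq_sym uv0 addr_ge0.
(* x + u and x + v are mirror convex combinations of x and x + u + v *)
have aux (a b : R) : a + b = u + v -> 0 <= a -> 0 <= b ->
    (x + a) `^ q <= b / (u + v) * x `^ q + a / (u + v) * (x + u + v) `^ q.
  move=> ab a0 b0.
  have t0 : 0 <= b / (u + v) by rewrite divr_ge0// ltW.
  have t1 : b / (u + v) <= 1 by rewrite ler_pdivrMr// mul1r -ab lerDr.
  have onemE : 1 - b / (u + v) = a / (u + v).
    by rewrite -{1}(divff uv0) -mulrBl -ab addrK.
  have := @convex_powR R q q1 (Itv01 t0 t1) x (x + u + v).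
  rewrite !inE/= !in_itv/= !andbT x0 !addr_ge0// => /(_ isT isT).
  rewrite [X in X `^ _ <= _ -> _]convRE convRE/= /unstable.onem onemE.
  have E : b / (u + v) * x + a / (u + v) * (x + u + v) = x + a.
    by rewrite -addrA mulrDr addrA -mulrDl -mulrDl (addrC b) ab divff// mul1r mulfVK.
  by rewrite -E.
have h1 := aux u v erefl u0 v0.
have h2 := aux v u (addrC _ _) v0 u0.
have e : u / (u + v) + v / (u + v) = 1 by rewrite -mulrDl divff.
apply: (le_trans (lerD h1 h2)); rewrite le_eqVlt; apply/orP; left; apply/eqP.
by rewrite (canRL (addrK _) e); ring.
Qed.

(** The absolute value makes the integral of this function at a sum the q-th power of its
    [Lnorm]. *)
Lemma growth_convex_powR : growth_convex q (fun x : R => (`|x| `^ q)%:E).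
Proof.
split.
- apply/measurable_EFinP; apply: (measurableT_comp (measurable_powR _)).
  exact: normr_measurable.
- by move=> x; rewrite lee_fin powR_ge0.
- exists 1 => // x; rewrite mul1r lee_fin ge0_ler_powR ?nnegrE ?addr_ge0//.
  by rewrite lerDr.
- move=> x u x0 u0; rewrite lee_fin ge0_ler_powR ?nnegrE//.
  by rewrite !ger0_norm ?addr_ge0// lerDl.
- move=> x u v x0 u0 v0; rewrite -!EFinD lee_fin !ger0_norm ?addr_ge0//.
  exact: powR_supadd.
Qed.

Context d (T : measurableType d) (P : probability T R).

Lemma le_weighted_moment (U W : T -> R) : measurable_fun [set: T] U ->
  (forall w, 0 <= U w) -> (forall w, U w <= W w) ->
  weighted_moment P q W -> weighted_moment P q U.
Proof.
move=> mU U0 UW [mW W0 Wfin]; split; [exact: mU|exact: U0|apply: (le_lt_trans _ Wfin)].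
have m1 (f : T -> R) : measurable_fun setT f ->
    measurable_fun setT (fun w => ((1 + f w) `^ q)%:E).
  move=> mf; apply/measurable_EFinP; apply: (measurableT_comp (measurable_powR _)).
  exact: measurable_funD.
apply: ge0_le_integral => //; [|exact: m1|exact: m1|].
- by move=> w _; rewrite lee_fin powR_ge0.
- move=> w _; rewrite lee_fin ge0_ler_powR ?nnegrE ?addr_ge0//.
  by rewrite lerD2l.
Qed.

Lemma Lnorm_weighted_moment (S : T -> R) : measurable_fun [set: T] S ->
  (forall w, 0 <= S w) -> (Lnorm P q%:E (EFin \o S) < +oo)%E ->
  weighted_moment P q S.
Proof.
move=> mS S0 NS; split => //.
have qn0 : q != 0 by rewrite gt_eqF// (lt_le_trans _ q1).
have IS := poweR_lty q NS; rewrite (poweR_Lnorm _ _ qn0) in IS.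
have mSq : measurable_fun setT (fun w => (S w `^ q)%:E).
  by apply/measurable_EFinP; exact: (measurableT_comp (measurable_powR _)).
(* (1 + S)^q <= 2^q (1 + S^q), because 1 + S is at most 2 when S <= 1 and at most 2 S otherwise. *)
apply: (@le_lt_trans _ _ (\int[P]_w ((2 `^ q)%:E * (1 + (S w `^ q)%:E)))%E).
  apply: ge0_le_integral => //.
  - by move=> w _; rewrite lee_fin powR_ge0.
  - apply/measurable_EFinP; apply: (measurableT_comp (measurable_powR _)).
    exact: measurable_funD.
  - by apply: emeasurable_funM => //; exact: emeasurable_funD.
  move=> w _; rewrite -EFinD -EFinM lee_fin.
  have p0 : 0 <= S w `^ q by exact: powR_ge0.
  have [Sw|Sw] := leP (S w) 1.
    apply: (@le_trans _ _ (2 `^ q)).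
      apply: ge0_ler_powR; rewrite ?nnegrE ?addr_ge0//.
      by rewrite (_ : 2 = 1 + 1) ?lerD2l//; ring.
    by rewrite ler_peMr ?powR_ge0// lerDl.
  apply: (@le_trans _ _ ((2 * S w) `^ q)).
    apply: ge0_ler_powR; rewrite ?nnegrE ?addr_ge0 ?mulr_ge0//.
    by lra.
  by rewrite powRM// ler_wpM2l ?powR_ge0// lerDr.
have m1S : measurable_fun setT (fun w => 1 + (S w `^ q)%:E)%E.
  exact: emeasurable_funD.
have p1 w : (0 <= 1 + (S w `^ q)%:E)%E.
  by rewrite -EFinD lee_fin addr_ge0// powR_ge0.
rewrite ge0_integralZl ?lee_fin ?powR_ge0//.
rewrite ge0_integralD//; last by move=> w _; rewrite lee_fin powR_ge0.
rewrite probability_integral_cst lte_mul_pinfty ?lee_fin ?powR_ge0//.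
apply: lte_add_pinfty; first exact: ltry.
apply: (le_lt_trans _ IS).
rewrite le_eqVlt; apply/orP; left; apply/eqP; apply: eq_integral => w _ /=.
by rewrite ger0_norm.
Qed.

(** The iterate is E (x + S_1 + ... + S_t)^q for independent copies of S; each copy costs one use of
    Minkowski against a constant. *)
Lemma iter_shift_mean_powR_le (S : T -> R) (t : nat) (x s : R) :
  weighted_moment P q S -> Lnorm P q%:E (EFin \o S) = s%:E -> 0 <= x ->
  (iter t (shift_mean P S) (fun x => (`|x| `^ q)%:E) x <=
   ((x + t%:R * s) `^ q)%:E)%E.
Proof.
move=> wS NS; have [mS S0 _] := wS.
have s0 : 0 <= s by rewrite -lee_fin -NS Lnorm_ge0.
have qn0 : q != 0 by rewrite gt_eqF// (lt_le_trans _ q1).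
elim: t x => [|t IH] x x0; first by rewrite mul0r addr0 /= ger0_norm.
rewrite iterS.
have [mg g0 _ _ _] := iter_shift_mean_gc q1 t wS growth_convex_powR.
have ts0 : 0 <= t%:R * s by rewrite mulr_ge0.
pose h (y : R) : \bar R := ((`|y + t%:R * s| `^ q)%:E).
have mh : measurable_fun [set: R] h.
  apply/measurable_EFinP; apply: (measurableT_comp (measurable_powR _)).
  by apply: measurableT_comp => //; exact: measurable_funD.
apply: (@le_trans _ _ (shift_mean P S h x)).
  apply: le_shift_mean => // y y0; rewrite /h ger0_norm ?addr_ge0//.
  exact: IH.
pose c := x + t%:R * s.
have c0 : 0 <= c by rewrite addr_ge0.
have -> : shift_mean P S h x = (Lnorm P q%:E (EFin \o (cst c \+ S)%R) `^ q)%E.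
  rewrite (poweR_Lnorm _ _ qn0); apply: eq_integral => w _ /=.
  by rewrite /h /c addrAC.
have -> : ((x + t.+1%:R * s) `^ q)%:E = ((c + s)%:E `^ q)%E.
  by rewrite poweR_EFin /c -natr1 mulrDl mul1r addrA.
have Nc : Lnorm P q%:E (EFin \o cst c) = c%:E.
  rewrite Lnorm.unlock /= (_ : (\int[P]_x _)%E = (c `^ q)%:E).
    by rewrite poweR_EFin -powRrM mulfV// powRr1.
  by rewrite -[RHS](probability_integral_cst P) ger0_norm.
apply: gt0_ler_poweR; rewrite ?in_itv/= ?leey ?andbT ?Lnorm_ge0 ?lee_fin ?addr_ge0//.
by rewrite EFinD -NS -Nc; exact: minkowski_EFin.
Qed.

End power_function.

Lemma poisson1_sum (R : realType) : (\sum_(0 <= t <oo) (poisson1 R t)%:E = 1)%E.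
Proof.
have : poisson_prob (1 : R) 0%N [set: nat] = 1%E by exact: probability_setT.
rewrite /poisson_prob ltr01 -nneseries_esumT; last first.
  by move=> t; rewrite lee_fin poisson_pmf_ge0.
move=> <-; apply: eq_eseriesr => t _.
by rewrite /poisson_pmf ltr01 expr1n mul1r mulrC.
Qed.

(** * The upper bound *)

Section decoupling.
Context (R : realType) (q : R).
Hypothesis q1 : 1 <= q.
Context d (T : measurableType d) (P : probability T R).
Context d' (T' : measurableType d') (P' : probability T' R).
Variables (n : nat) (Y : 'I_n -> {RV P >-> R}) (X : 'I_n -> {RV P' >-> R}).
Hypothesis Y0 : forall i w, 0 <= Y i w.
Hypothesis indepX : mutually_independent X.
Hypothesis XY : forall i, same_distribution (X i) (Y i).

Let qn0 : q != 0. Proof. by rewrite gt_eqF// (lt_le_trans _ q1). Qed.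

Lemma poisson_mean0 (U : T -> R) (g : R -> \bar R) x : (forall w, U w = 0) ->
  growth_convex q g -> poisson_mean P U g x = g x.
Proof.
move=> U0 cg.
have -> : poisson_mean P U g x = (\sum_(0 <= t <oo) (fine (g x))%:E * (poisson1 R t)%:E)%E.
  apply: eq_eseriesr => t _; rewrite muleC -(gc_fin x cg); congr (_ * _)%E.
  elim: t => [//|t IH]; rewrite iterS /shift_mean.
  under eq_integral do rewrite U0 addr0.
  by rewrite probability_integral_cst.
rewrite nneseriesZl ?poisson1_sum ?mule1 -?(gc_fin x cg)// => t _.
by rewrite lee_fin poisson1_ge0.
Qed.

(** Induction on s for all g: integrating out X j replaces g by K_(Y j) g, still in the cone. The
    induction hypothesis is used for this new function, and [poisson_meanD] then absorbs Y j. *)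
Lemma integral_le_poisson_mean (s : seq 'I_n) (g : R -> \bar R) (x : R) :
  weighted_moment P q (fun w => \sum_i Y i w) ->
  uniq s -> growth_convex q g -> 0 <= x ->
  (\int[P']_w g (x + \sum_(i <- s) X i w)%R <=
   poisson_mean P (fun w => \sum_(i <- s) Y i w)%R g x)%E.
Proof.
move=> wY.
have wsub (r : seq 'I_n) : uniq r -> weighted_moment P q (fun w => \sum_(i <- r) Y i w).
  move=> ur; apply: (le_weighted_moment q1 _ _ _ wY).
  - by apply: measurable_sum => i; exact: measurable_funP.
  - by move=> w; exact: sumr_ge0.
  - by move=> w; rewrite big_uniq//= big_mkcond/= ler_sum// => i _; case: ifP.
elim: s g => [|j s IH] g us cg x0.
  under eq_integral do rewrite big_nil addr0.
  by rewrite probability_integral_cst poisson_mean0// => w; rewrite big_nil.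
have /andP[js us'] := us.
have [mg g0 _ _ _] := cg.
have wj : weighted_moment P q (Y j).
  apply: (le_weighted_moment q1 _ _ _ wY) => //.
  by move=> w; rewrite (bigD1 j)//= lerDl sumr_ge0.
have E : (fun w => \sum_(i <- j :: s) Y i w) = (fun w => \sum_(i <- s) Y i w) \+ Y j.
  by apply/funext => w; rewrite big_cons addrC.
rewrite integral_partial_sumS// (shift_mean_distribution mg g0 (XY j)).
apply: (le_trans (IH _ us' (shift_mean_gc q1 wj cg) x0)).
rewrite E; apply: (poisson_meanD q1) => //; first exact: wsub.
by rewrite -E; exact: wsub.
Qed.

Lemma fractional_bell_gt0 : (0 < fractional_bell q)%E.
Proof.
apply: (@lt_le_trans _ _ (\sum_(1 <= t < 2)
    (((t%:R : R) `^ q) * expR (-1) / (t`!)%:R)%:E)%E).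
  by rewrite big_nat1 powR1 mul1r divr1 lte_fin expR_gt0.
apply: nneseries_lim_ge => t _ _.
by rewrite lee_fin divr_ge0// mulr_ge0 ?expR_ge0 ?powR_ge0.
Qed.

Lemma Lq_sum_decoupling :
  (Lq_sum X q <= (fractional_bell q) `^ q^-1 * Lq_sum Y q)%E.
Proof.
have q0 : 0 < q by exact: lt_le_trans q1.
(* If the norm of the sum of the Y_i is infinite, positivity of the constant makes the right-hand
   side infinite. *)
have [NY|] := ltP (Lq_sum Y q) +oo%E; last first.
  rewrite leye_eq => /eqP ->.
  by rewrite muleC gt0_mulye ?leey// poweR_gt0// fractional_bell_gt0.
have mY : measurable_fun [set: T] (fun w => \sum_i Y i w).
  by apply: measurable_sum => i; exact: measurable_funP.
have wY : weighted_moment P q (fun w => \sum_i Y i w).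
  by apply: (Lnorm_weighted_moment q1) => // w; exact: sumr_ge0.
pose s := fine (Lq_sum Y q).
have sE : Lq_sum Y q = s%:E by rewrite /s fineK// ge0_fin_numE// Lnorm_ge0.
have s0 : 0 <= s by rewrite fine_ge0// Lnorm_ge0.
have XqE : (Lq_sum X q `^ q <= fractional_bell q * (s `^ q)%:E)%E.
  rewrite /Lq_sum poweR_Lnorm//.
  have le0R : (0 : R) <= 0 by [].
  have := integral_le_poisson_mean wY (index_enum_uniq _) (growth_convex_powR q1) le0R.
  have -> : (\int[P']_w (`|0 + \sum_(i <- index_enum 'I_n) X i w| `^ q)%:E =
      \int[P']_w `|(\sum_i X i w)%:E| `^ q)%E.
    by apply: eq_integral => w _; rewrite add0r.
  move/le_trans; apply.
  apply: (@le_trans _ _ (\sum_(0 <= t <oo) (poisson1 R t)%:E *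
      ((t%:R * s) `^ q)%:E)%E).
    apply: lee_nneseries => [t _ _|t _].
      rewrite mule_ge0 ?lee_fin ?poisson1_ge0//.
      exact: gc_ge0 (iter_shift_mean_gc q1 t wY (growth_convex_powR q1)) _.
    rewrite lee_wpmul2l ?lee_fin ?poisson1_ge0//.
    by rewrite -[t%:R * s]add0r; exact: iter_shift_mean_powR_le.
  (* The term t = 0 vanishes because q is nonzero, leaving the series of [fractional_bell], which
     starts at 1. *)
  rewrite nneseries_recl//; last first.
    by move=> t _; rewrite -EFinM lee_fin mulr_ge0 ?poisson1_ge0 ?powR_ge0.
  rewrite mul0r powR0// mule0 add0e muleC -nneseriesZl; last first.
    move=> t _; rewrite lee_fin divr_ge0// mulr_ge0 ?expR_ge0 ?powR_ge0//.
  rewrite le_eqVlt; apply/orP; left; apply/eqP; apply: eq_eseriesr => t _.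
  rewrite -!EFinM powRM// /poisson1; congr EFin; ring.
rewrite -[leLHS]poweRe1 ?Lnorm_ge0// -(mulfV qn0) poweRrM.
rewrite sE -[s in leRHS]powRr1// -(mulfV qn0) powRrM -poweR_EFin -poweRM; last 2 first.
- exact: ltW fractional_bell_gt0.
- by rewrite lee_fin powR_ge0.
apply: gt0_ler_poweR => //.
- by rewrite invr_ge0 ltW.
- by rewrite in_itv/= leey andbT poweR_ge0.
- rewrite in_itv/= leey andbT mule_ge0 ?lee_fin ?powR_ge0//.
  exact: ltW fractional_bell_gt0.
Qed.

End decoupling.

(** * Sharpness *)

Lemma measurable_fun_nat d (T : measurableType d) (f : nat -> T) :
  measurable_fun [set: nat] f.
Proof. by []. Qed.

(** * Uniform laws on finite types *)

Section uniform.
Context (R : realType).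

Lemma uniform_weight_ge0 N : 0 <= (N.+1%:R : R)^-1.
Proof. by rewrite invr_ge0. Qed.

(* The uniform law on N.+1 points, carried by the first N.+1 natural numbers
   since a finType has no canonical measurable structure; decode transports it
   to a finType. *)
Definition uniform_prob (N : nat) : set nat -> \bar R :=
  mscale (NngNum (uniform_weight_ge0 N))
    (msum (fun k => \d_k : {measure set nat -> \bar R}) N.+1).

HB.instance Definition _ N := Measure.on (uniform_prob N).

Lemma uniform_prob_setT N : uniform_prob N [set: nat] = 1%E.
Proof.
transitivity ((N.+1%:R^-1)%:E * \sum_(k < N.+1) (1 : R)%:E)%E.
  by congr (_ * _)%E; apply: eq_bigr => k _; rewrite /= diracT.
by rewrite sumEFin sumr_const card_ord -EFinM mulVf.
Qed.

HB.instance Definition _ N :=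
  Measure_isProbability.Build _ _ R (uniform_prob N) (uniform_prob_setT N).

Context (I : finType) (i0 : I).

(** From #|I| on the value is the default i0; these points carry no mass. *)
Definition decode (k : nat) : I := nth i0 (enum I) k.

(** [uniform_prob N] has N + 1 atoms, so the law on I has index [#|I|.-1]; i0 shows that I is
    nonempty. *)
Let cardI : #|I|.-1.+1 = #|I|.
Proof. by rewrite prednK//; apply/card_gt0P; exists i0. Qed.

Lemma sum_decode (F : I -> \bar R) :
  (\sum_(k < #|I|) F (decode k) = \sum_i F i)%E.
Proof.
by rewrite -(big_mkord xpredT (fun k => F (decode k))) cardE -[in RHS]big_enum
  [RHS](big_nth i0).
Qed.

Lemma uniform_probE (B : pred I) :
  uniform_prob #|I|.-1 [set k | B (decode k)] = (#|B|%:R / #|I|%:R)%:E.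
Proof.
transitivity ((#|I|.-1.+1%:R^-1)%:E *
    \sum_(k < #|I|.-1.+1) ((B (decode k))%:R : R)%:E)%E.
  congr (_ * _)%E; apply: eq_bigr => k _; rewrite /= diracE.
  congr ((nat_of_bool _)%:R%:E).
  by apply/idP/idP => [/set_mem//|h]; apply/mem_set.
rewrite cardI (sum_decode (fun i => (B i)%:R%:E)) sumEFin -EFinM mulrC.
congr ((_ / _)%:E); rewrite -sum1_card natr_sum [RHS]big_mkcond.
by apply: eq_bigr => i _; rewrite -topredE /=; case: (B i).
Qed.

Definition uniform_rv (f : I -> R) : {RV (uniform_prob #|I|.-1) >-> R} :=
  mfun_Sub (mem_set (measurable_fun_nat (f \o decode))).

Lemma integral_uniform (F : I -> R) : (forall i, 0 <= F i) ->
  (\int[uniform_prob #|I|.-1]_k (F (decode k))%:E =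
   ((\sum_i F i) / #|I|%:R)%:E)%E.
Proof.
move=> F0; have mF : measurable_fun [set: nat] (fun k => (F (decode k))%:E) by [].
rewrite ge0_integral_mscale//; last by move=> k _; rewrite lee_fin.
rewrite ge0_integral_measure_sum//; last by move=> k _; rewrite lee_fin.
under eq_bigr do rewrite integral_dirac// diracT mul1e.
by rewrite /= cardI (sum_decode (fun i => (F i)%:E)) sumEFin -EFinM mulrC.
Qed.

End uniform.

(** * Counting functions by their fixed points *)

Lemma card_forall_ffun (aT rT : finType) (D : aT -> pred rT) :
  #|[pred f : {ffun aT -> rT} | [forall i, D i (f i)]]| = (\prod_i #|D i|)%N.
Proof.
have := @card_family aT (fun=> rT) D; rewrite foldrE big_image /= => <-.
by apply: eq_card => f; rewrite !inE; apply: eq_forallb => i.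
Qed.

(** Functions are grouped by their set A of fixed points, and the sets by size. Given A, each point
    outside A has n - 1 possible images and each point of A has one. *)
Lemma sum_fixpoints (R : realType) (n : nat) (G : nat -> R) :
  \sum_(f : {ffun 'I_n -> 'I_n}) G #|[set i | f i == i]%SET| =
  \sum_(t < n.+1) 'C(n, t)%:R * (n.-1 ^ (n - t))%:R * G t.
Proof.
rewrite (partition_big (fun f : {ffun 'I_n -> 'I_n} => [set i | f i == i]%SET) xpredT)//=.
transitivity (\sum_(A : {set 'I_n}) (n.-1 ^ (n - #|A|))%:R * G #|A|).
  apply: eq_bigr => A _.
  rewrite (eq_bigr (fun=> G #|A|)); last by move=> f /eqP ->.
  pose D (i : 'I_n) : pred 'I_n := fun j => (j == i) == (i \in A).
  rewrite (eq_bigl (fun f => f \in [pred f : {ffun 'I_n -> 'I_n} | [forall i, D i (f i)]])).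
    rewrite sumr_const card_forall_ffun mulr_natl; congr (_ *+ _).
    rewrite (eq_bigr (fun i => if i \in (~: A)%SET then n.-1 else 1%N)).
      by rewrite -big_mkcond prod_nat_const cardsCs finset.setCK card_ord.
    move=> i _; rewrite inE /D; case: (i \in A).
      by rewrite (eq_card (_ : _ =i pred1 i)) ?card1// => j; rewrite !inE /= -topredE /= eqb_id.
    rewrite (eq_card (_ : _ =i predC1 i)) ?cardC1 ?card_ord// => j.
    by rewrite !inE /= -topredE /= eqbF_neg.
  move=> f; rewrite inE /=; apply/eqP/forallP => [fA i|H].
    by rewrite /D -fA inE.
  by apply/finset.setP => i; rewrite inE; have /eqP := H i.
rewrite (partition_big (fun A : {set 'I_n} => inord #|A| : 'I_n.+1) xpredT)//=.
apply: eq_bigr => t _.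
have cardE (A : {set 'I_n}) : (inord #|A| == t :> 'I_n.+1) = (#|A| == t).
  by rewrite -val_eqE /= inordK// ltnS -[X in (_ <= X)%N]card_ord max_card.
rewrite (eq_bigr (fun=> (n.-1 ^ (n - t))%:R * G t)); last first.
  by move=> A; rewrite cardE => /eqP ->.
rewrite (eq_bigl (fun A => A \in [set A : {set 'I_n} | #|A| == t]%SET)); last first.
  by move=> A; rewrite inE cardE.
by rewrite sumr_const card_draws card_ord -[LHS]mulr_natl mulrA.
Qed.

(** * The extremal variables *)

Section extremal.
Context (R : realType) (m : nat).
Let n := m.+1.

Definition diag_indicator (i j : 'I_n) : R := (j == i)%:R.

Definition extremal_Y (i : 'I_n) := uniform_rv ord0 (diag_indicator i).

(* The event f i = i has probability 1 / n, and the coordinates of a uniform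
   f : {ffun 'I_n -> 'I_n} are independent, so the X_i sum to the number of
   fixed points of f. *)
Definition extremal_X (i : 'I_n) :=
  uniform_rv [ffun=> ord0] (fun f : {ffun 'I_n -> 'I_n} => diag_indicator i (f i)).

Let cardn : #|{: 'I_n}| = n. Proof. exact: card_ord. Qed.

Lemma extremal_Y_prob i (B : set R) :
  uniform_prob R #|'I_n|.-1 (extremal_Y i @^-1` B) =
  (#|[pred j | `[< B (diag_indicator i j) >]]|%:R / n%:R)%:E.
Proof.
rewrite -[X in _ / X%:R]cardn -(uniform_probE _ ord0); congr (uniform_prob _ _ _).
by apply/seteqP; split => k /=; rewrite asboolE.
Qed.

(** The maps satisfying all constraints are counted by a product over i, and dividing by n^n gives
    each factor its own 1 / n. *)
Lemma extremal_X_prob (B : 'I_n -> set R) :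
  uniform_prob R #|{ffun 'I_n -> 'I_n}|.-1
    (\bigcap_(i in [set: 'I_n]) (extremal_X i @^-1` B i)) =
  (\prod_(i < n) (#|[pred j | `[< B i (diag_indicator i j) >]]|%:R / n%:R)%:E)%E.
Proof.
pose D i := [pred j | `[< B i (diag_indicator i j) >]].
transitivity (uniform_prob R #|{ffun 'I_n -> 'I_n}|.-1
   [set k | [pred f : {ffun 'I_n -> 'I_n} | [forall i, D i (f i)]]
      (decode [ffun=> ord0] k)]).
  congr (uniform_prob _ _ _); apply/seteqP; split => k /=.
    by move=> H; apply/forallP => i; apply/asboolP; exact: (H i I).
  by move=> /forallP H i _; have := H i; rewrite /= asboolE.
rewrite (uniform_probE _ [ffun=> ord0]
  [pred f : {ffun 'I_n -> 'I_n} | [forall i, D i (f i)]]).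
rewrite (_ : #|_| = (\prod_i #|D i|)%N); last exact: card_forall_ffun.
rewrite card_ffun !card_ord.
rewrite prodEFin; congr EFin.
by rewrite prodf_div natr_prod natrX prodr_const card_ord.
Qed.

Lemma extremal_X_prob1 (i : 'I_n) (B : set R) :
  uniform_prob R #|{ffun 'I_n -> 'I_n}|.-1 (extremal_X i @^-1` B) =
  (#|[pred j | `[< B (diag_indicator i j) >]]|%:R / n%:R)%:E.
Proof.
pose B' (j : 'I_n) := if j == i then B else setT.
have -> : extremal_X i @^-1` B = \bigcap_(j in [set: 'I_n]) (extremal_X j @^-1` B' j).
  apply/seteqP; split => w /=.
    by move=> Bw j _ /=; rewrite /B'; case: eqP => // ->.
  by move=> /(_ i I) /=; rewrite /B' eqxx.
rewrite extremal_X_prob (bigD1 i)//= [X in (_ * X)%E]big1 ?mule1 /B' ?eqxx// => j ji.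
rewrite (negPf ji) (_ : #|_| = n) ?divff ?pnatr_eq0//.
transitivity #|{: 'I_n}|; last exact: cardn.
by apply: eq_card => k; rewrite !inE; apply/asboolP.
Qed.

Lemma extremal_indep : mutually_independent extremal_X.
Proof.
move=> B mB; apply: (etrans (extremal_X_prob B)); apply: eq_bigr => i _.
exact: esym (extremal_X_prob1 i (B i)).
Qed.

Lemma extremal_same_distribution i :
  same_distribution (extremal_X i) (extremal_Y i).
Proof.
by move=> B mB; apply: (etrans (extremal_X_prob1 i B)); exact: esym (extremal_Y_prob i B).
Qed.

Variable q : R.
Hypothesis q1 : 1 <= q.
Let qn0 : q != 0. Proof. by rewrite gt_eqF// (lt_le_trans _ q1). Qed.

Lemma Lq_extremal_Y : Lq_sum extremal_Y q = 1%E.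
Proof.
rewrite /Lq_sum Lnorm.unlock /=.
rewrite (_ : (\int[_]_x _)%E = 1%E); first by rewrite poweR_EFin powR1.
transitivity (\int[uniform_prob R #|'I_n|.-1]_k (1 : \bar R))%E; last first.
  by rewrite integral_cst// mul1e; exact: uniform_prob_setT.
apply: eq_integral => k _.
rewrite /diag_indicator (bigD1 (decode ord0 k))//= eqxx big1 ?addr0; last first.
  by move=> i /negPf ik; rewrite eq_sym ik.
by rewrite normr1 powR1.
Qed.

(** The weights are those of the binomial law (n, 1/n), with m = n - 1. *)
Lemma Lq_extremal_X : (Lq_sum extremal_X q `^ q =
  (\sum_(t < n.+1) 'C(n, t)%:R * (m ^ (n - t))%:R / (n ^ n)%:R * t%:R `^ q)%:E)%E.
Proof.
rewrite /Lq_sum poweR_Lnorm//.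
pose F (f : {ffun 'I_n -> 'I_n}) : R := (#|[set i | f i == i]%SET|%:R) `^ q.
transitivity (\int[uniform_prob R #|{ffun 'I_n -> 'I_n}|.-1]_k
   (F (decode [ffun=> ord0] k))%:E)%E.
  apply: eq_integral => k _; rewrite /F /=; congr (_ `^ _)%:E.
  rewrite ger0_norm; last by rewrite sumr_ge0.
  rewrite -sum1_card natr_sum [RHS]big_mkcond/=; apply: eq_bigr => i _.
  by rewrite /diag_indicator inE; case: eqP.
rewrite integral_uniform; last by move=> f; exact: powR_ge0.
congr EFin; rewrite /F (sum_fixpoints n (fun t => t%:R `^ q)).
rewrite card_ffun card_ord mulr_suml; apply: eq_bigr => t _ /=; ring.
Qed.

End extremal.

(** * Lower bounds for the binomial moments *)

Lemma bernoulli_ineq (R : realType) (y : R) (t : nat) : 0 <= y -> y <= 1 ->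
  1 - t%:R * y <= (1 - y) ^+ t.
Proof.
move=> y0 y1; elim: t => [|t IH]; first by rewrite mul0r subr0 expr0.
have y1' : 0 <= 1 - y by rewrite subr_ge0.
rewrite exprS; apply: le_trans (ler_wpM2l y1' IH).
rewrite -natr1; have := mulr_ge0 (ler0n R t) (sqr_ge0 y); nra.
Qed.

Lemma ffact_ge_exp (n t : nat) : (t <= n)%N -> ((n - t) ^ t <= n ^_ t)%N.
Proof.
move=> tn; rewrite ffact_prod -[X in (_ ^ X)%N]card_ord -prod_nat_const.
by apply: leq_prod => i _; rewrite leq_sub2l// ltnW.
Qed.

(** A one-sided Poisson limit with explicit error, the product of three bounds: 'C(n, t) >= (n -
    t)^t / t!, m^(n - t) >= e^(-1) n^(n - t), and Bernoulli for (1 - t / n)^t. *)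
Lemma binomial_weight_ge (R : realType) (m t : nat) : (0 < m)%N ->
  (0 < t <= m.+1)%N ->
  expR (-1) / t`!%:R * (1 - t%:R ^+ 2 / m.+1%:R) <=
  'C(m.+1, t)%:R * (m ^ (m.+1 - t))%:R / (m.+1 ^ m.+1)%:R :> R.
Proof.
move=> m0 /andP[t0 tn]; set n := m.+1.
have n0 : (0 : R) < n%:R by rewrite ltr0n.
have tf0 : (0 : R) < t`!%:R by rewrite ltr0n fact_gt0.
have mR : (0 : R) < m%:R by rewrite ltr0n.
have h1 : (n - t)%:R ^+ t / t`!%:R <= 'C(n, t)%:R :> R.
  by rewrite ler_pdivrMr// -natrM bin_ffact -natrX ler_nat ffact_ge_exp.
have h2 : expR (-1) * n%:R ^+ (n - t) <= m%:R ^+ (n - t) :> R.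
  (* (1 + 1/m)^(n - t) <= e because n - t <= m; this needs 0 < t *)
  have nm : (n%:R : R) <= m%:R * expR m%:R^-1.
    have -> : n%:R = m%:R * (1 + m%:R^-1) :> R.
      by rewrite mulrDr mulr1 divff ?gt_eqF// natr1.
    by apply: (ler_wpM2l (ltW mR)); exact: expR_ge1Dx.
  have nk : (n%:R : R) ^+ (n - t) <= (m%:R * expR m%:R^-1) ^+ (n - t).
    by rewrite lerXn2r// nnegrE ?ltW// mulr_gt0// expR_gt0.
  apply: (le_trans (ler_wpM2l (expR_ge0 _) nk)).
  rewrite exprMn -expRM_natl mulrCA -expRD.
  apply: ler_piMr; first by rewrite exprn_ge0// ltW.
  rewrite expR_le1 addrC subr_le0 ler_pdivrMr// mul1r ler_nat /n.
  by rewrite leq_subLR -add1n leq_add2r.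
have h3 : 1 - t%:R ^+ 2 / n%:R <= ((n - t)%:R / n%:R) ^+ t :> R.
  have -> : (n - t)%:R / n%:R = 1 - t%:R / n%:R :> R.
    by rewrite natrB// mulrBl divff// gt_eqF.
  rewrite expr2 -mulrA; apply: bernoulli_ineq.
    by rewrite divr_ge0.
  by rewrite ler_pdivrMr// mul1r ler_nat.
apply: (le_trans (ler_wpM2l (divr_ge0 (expR_ge0 _) (ltW tf0)) h3)).
have nt0 : (0 : R) < n%:R ^+ t by rewrite exprn_gt0.
have nk0 : (0 : R) < n%:R ^+ (n - t) by rewrite exprn_gt0.
have -> : (n ^ n)%:R = n%:R ^+ (n - t) * n%:R ^+ t :> R.
  by rewrite -exprD subnK// natrX.
rewrite invfM mulrA expr_div_n mulrA ler_pM2r ?invr_gt0// natrX.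
rewrite ler_pdivlMr// -mulrA.
apply: le_trans (ler_pM _ _ h1 h2); last 2 first.
- by rewrite divr_ge0 ?exprn_ge0// ltW.
- by rewrite mulr_ge0 ?expR_ge0// ltW.
by rewrite le_eqVlt; apply/orP; left; apply/eqP; ring.
Qed.

(** Only the terms 1 <= t < T are kept, the others being nonnegative, and t^2 <= T^2 makes the error
    factor uniform. The bound on T ensures t <= n. *)
Lemma extremal_moment_ge (R : realType) (q : R) (m T : nat) : 1 <= q ->
  (0 < m)%N -> (T <= m.+2)%N ->
  (((\sum_(1 <= t < T) t%:R `^ q * expR (-1) / t`!%:R) *
    (1 - T%:R ^+ 2 / m.+1%:R))%R%:E <= Lq_sum (@extremal_X R m) q `^ q)%E.
Proof.
move=> q1 m0 Tm; rewrite Lq_extremal_X// lee_fin.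
set G := fun t : nat => 'C(m.+1, t)%:R * (m ^ (m.+1 - t))%:R /
  (m.+1 ^ m.+1)%:R * t%:R `^ q : R.
have G0 t : 0 <= G t by rewrite mulr_ge0 ?powR_ge0// divr_ge0// mulr_ge0.
rewrite -(big_mkord xpredT G).
apply: (@le_trans _ _ (\sum_(1 <= t < T) G t)); last first.
  have [->|T0] := posnP T; first by rewrite [leLHS]big_geq// sumr_ge0.
  rewrite [leRHS](big_cat_nat _ Tm)//= [X in _ <= X + _](@big_cat_nat _ _ _ 1%N)//=.
  by rewrite addrAC lerDr addr_ge0// sumr_ge0.
rewrite mulr_suml big_nat_cond [leRHS]big_nat_cond.
apply: ler_sum => t /andP[/andP[t1 tT] _]; rewrite /G.
have tm : (0 < t <= m.+1)%N by rewrite t1 -ltnS (leq_trans tT Tm).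
rewrite [leRHS]mulrC -!mulrA; apply: ler_wpM2l; first exact: powR_ge0.
rewrite !mulrA; apply: le_trans (binomial_weight_ge R m0 tm).
apply: ler_wpM2l; first by rewrite divr_ge0// expR_ge0.
rewrite lerD2l lerN2; apply: ler_wpM2r; first by rewrite invr_ge0.
by rewrite lerXn2r ?nnegrE// ler_nat ltnW.
Qed.

Lemma decoupling_sharp (R : realType) (q C : R) : 1 <= q ->
  (C%:E < fractional_bell q `^ q^-1)%E ->
  exists m, ~ (Lq_sum (@extremal_X R m) q <= C%:E)%E.
Proof.
move=> q1 CA.
have q0 : 0 < q by exact: lt_le_trans q1.
have qn0 : q != 0 by rewrite gt_eqF.
(* C may be negative; its positive part allows q-th powers to be compared. *)
pose C' := Num.max C 0.
have C'0 : 0 <= C' by rewrite le_max lexx orbT.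
have C'A : (C'%:E < fractional_bell q `^ q^-1)%E.
  rewrite /C'; case: (leP C 0) => // _.
  by rewrite poweR_gt0// fractional_bell_gt0.
have C'qA : ((C' `^ q)%:E < fractional_bell q)%E.
  rewrite ltNge; apply/negP => AC; move: C'A; apply/negP; rewrite -leNgt.
  have -> : C'%:E = ((C' `^ q)%:E `^ q^-1)%E.
    by rewrite poweR_EFin -powRrM mulfV// powRr1.
  apply: gt0_ler_poweR; rewrite ?in_itv/= ?leey ?andbT ?lee_fin ?powR_ge0//.
  - by rewrite invr_ge0 ltW.
  - exact: ltW (fractional_bell_gt0 q).
pose a T : R := \sum_(1 <= t < T) t%:R `^ q * expR (-1) / t`!%:R.
(* Otherwise every partial sum, hence the whole series, would be at most C'^q. *)
have [T aT] : exists T, C' `^ q < a T.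
  apply: contrapT => /forallNP H; move: C'qA; apply/negP; rewrite -leNgt.
  apply: lime_le.
    apply: is_cvg_nneseries => t _ _.
    by rewrite lee_fin divr_ge0// mulr_ge0 ?expR_ge0 ?powR_ge0.
  apply: nearW => T; rewrite sumEFin lee_fin leNgt.
  by apply/negP; exact: H.
have aT0 : 0 < a T by apply: le_lt_trans aT; exact: powR_ge0.
pose gap := a T - C' `^ q.
have gap0 : 0 < gap by rewrite subr_gt0.
(* The first entry gives m > 0 and T <= m + 2; the second gives a_T T^2 / (m + 1) < gap, so the
   error factor costs less than the gap. *)
pose m := maxn T.+1 (Num.truncn (a T * T%:R ^+ 2 / gap)).
have m0 : (0 < m)%N by rewrite leq_max.
have Tm : (T <= m.+2)%N.
  by do 2!apply: leqW; apply: (leq_trans (leqnSn T)); exact: leq_maxl.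
exists m => LC.
have LC' : (Lq_sum (@extremal_X R m) q `^ q <= (C' `^ q)%:E)%E.
  rewrite -poweR_EFin; apply: gt0_ler_poweR.
  - exact: ltW.
  - by rewrite in_itv/= leey andbT Lnorm_ge0.
  - by rewrite in_itv/= leey andbT lee_fin.
  - by apply: (le_trans LC); rewrite lee_fin le_max lexx.
have := le_trans (extremal_moment_ge q1 m0 Tm) LC'.
rewrite lee_fin -/(a T) leNgt => /negP; apply.
rewrite mulrBr mulr1 ltrBrDr -ltrBrDl mulrA ltr_pdivrMr ?ltr0n//.
rewrite -/gap [ltRHS]mulrC -ltr_pdivrMr//.
apply: (lt_le_trans (truncnS_gt _)).
by rewrite ler_nat ltnS leq_maxr.
Qed.

Theorem theorem2 (R : realType) (q : R) (hq : 1 <= q) :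
  (forall (n : nat)
     (d : measure_display) (T : measurableType d) (P : probability T R)
     (d' : measure_display) (T' : measurableType d') (P' : probability T' R)
     (Y : 'I_n -> {RV P >-> R}) (X : 'I_n -> {RV P' >-> R}),
     (forall i w, 0 <= Y i w) ->
     mutually_independent X ->
     (forall i, same_distribution (X i) (Y i)) ->
     (Lq_sum X q <= (fractional_bell q) `^ q^-1 * Lq_sum Y q)%E)
  /\
  (forall C : R, (C%:E < (fractional_bell q) `^ q^-1)%E ->
     exists (n : nat)
       (d : measure_display) (T : measurableType d) (P : probability T R)
       (d' : measure_display) (T' : measurableType d') (P' : probability T' R)
       (Y : 'I_n -> {RV P >-> R}) (X : 'I_n -> {RV P' >-> R}),
       [/\ (forall i w, 0 <= Y i w),
           mutually_independent X,
           (forall i, same_distribution (X i) (Y i)) &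
           ~ (Lq_sum X q <= C%:E * Lq_sum Y q)%E]).
Proof.
split=> [n d T P d' T' P' Y X Y0 indepX XY|C CA].
  exact: Lq_sum_decoupling.
have [m LC] := decoupling_sharp hq CA.
exists m.+1, _, _, _, _, _, _, (@extremal_Y R m), (@extremal_X R m).
split; [|exact: extremal_indep|exact: extremal_same_distribution|].
  by move=> i w; exact: ler0n.
by rewrite Lq_extremal_Y mule1.
Qed.
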